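(* Let $G$ be an ordered abelian group and $H \subsetneq G$ a convex subgroup. Write $\Gamma := v_G(G\setminus\{0\})$ and $\Gamma_H := v_G(H\setminus\{0\})$. (1) If $\Gamma \setminus \Gamma_H$ has a maximum and there is an integer $n \geq 2$ such that $G/H$ has no non-trivial $n$-divisible convex subgroup, then $H$ is $\mathcal{L}_{\mathrm{og}}$-definable in $G$. (2) If for some integer $n \geq 2$ the quotient $G/H$ has a non-trivial $n$-divisible convex subgroup, $\Gamma_H$ does not have a minimum, and for every convex subgroup $H' \subsetneq H$ the quotient $H/H'$ is not $n$-divisible, then $H$ is $\mathcal{L}_{\mathrm{og}}$-definable in $G$. (3) If for some integer $n \geq 2$ the quotient $G/H$ has no non-trivial convex $n$-divisible subgroup and $\Gamma_H$ has a minimum, then $H$ is $\mathcal{L}_{\mathrm{og}}$-definable in $G$. (4) If for some integer $n \geq 2$ the quotient $G/H$ has no non-trivial convex $n$-divisible subgroup and for some convex subgroup $H' \subsetneq H$ the quotient $H/H'$ is $n$-divisible, then $H$ is $\mathcal{L}_{\mathrm{og}}$-definable in $G$.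
   Context: All orderings are linear. $\mathcal{L}_{\mathrm{og}}=\{+,-,0,<\}$ is the language of ordered groups, and ''definable'' means first-order definable with parameters from the structure. Two elements $a,b \in G$ are archimedean equivalent, $a\sim b$, if there is $n\in\mathbb{N}=\{1,2,\dots\}$ with $|a|\le n|b|$ and $|b|\le n|a|$; $[a]_+$ denotes the equivalence class of $a$. The set of classes is ordered by $[a]_+<[b]_+ :\Leftrightarrow |a|>|b|$ and $a\not\sim b$. The natural valuation on $G$ is $v_G\colon a\mapsto [a]_+$. Quotients by convex subgroups carry the induced ordering. *)

(* Defs.v *)
From HB Require Import structures.
From mathcomp Require Import all_boot all_order all_algebra ring_quotient.
From mathcomp Require Import boolp classical_sets.

Set Implicit Arguments.
Unset Strict Implicit.
Unset Printing Implicit Defensive.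

Import Order.TTheory GRing.Theory.

Local Open Scope classical_set_scope.
Local Open Scope ring_scope.
Local Open Scope quotient_scope.

(* Linearly ordered abelian groups. [porderZmodType] carries a partial order and
   a group law without any compatibility between them. Totality is an axiom here
   instead of [Order.Total] being a parent, because of the join that
   Hierarchy-Builder would then need with the existing [realDomainType]. *)
HB.mixin Record POrderedZmodule_isOrdered G of Num.POrderedZmodule G := {
  leg_total : forall x y : G, (x <= y) || (y <= x);
  legD2l : forall z x y : G, x <= y -> z + x <= z + y
}.

#[short(type="orderedZmodType")]
HB.structure Definition OrderedZmodule :=
  {G of POrderedZmodule_isOrdered G & Num.POrderedZmodule G}.

Definition convex (G : orderedZmodType) (S : {pred G}) : Prop :=
  forall x y z : G, x \in S -> z \in S -> x <= y -> y <= z -> y \in S.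

HB.mixin Record isConvex (G : orderedZmodType) (S : G -> bool) := {
  convex_subproof : convex S
}.

#[short(type="convexSubgroup")]
HB.structure Definition ConvexSubgroup (G : orderedZmodType) :=
  {S of GRing.ZmodClosed G S & isConvex G S}.

(* The group structure is the one of [Quotient.quot]; the order is the induced
   one: the image of [<=] under the projection. *)
Section OrderedQuotient.
Variables (G : orderedZmodType) (H : convexSubgroup G).

Definition quog : Type := Quotient.quot H.

HB.instance Definition _ := GRing.Zmodule.on quog.
HB.instance Definition _ :=
  EqQuotient.copy quog (Quotient.quot H).

Definition quog_proj (a : G) : quog := \pi_quog a.

Definition quog_le (x y : quog) : bool :=
  `[< exists a b : G, [/\ quog_proj a = x, quog_proj b = y & a <= b] >].

Lemma quog_projP (x : quog) : exists a, quog_proj a = x.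
Proof. by exists (repr x); rewrite /quog_proj reprK. Qed.

Lemma quog_proj_eq (a b : G) : quog_proj a = quog_proj b <-> a - b \in H.
Proof.
rewrite (Quotient.idealrBE (H : zmodClosed G)).
exact: (rwP (@eqP (Quotient.quot H) _ _)).
Qed.

Lemma quog_projD (a b : G) : quog_proj (a + b) = quog_proj a + quog_proj b.
Proof. exact: (raddfD (\pi_(Quotient.quot H))). Qed.

Lemma quog_leE (a b : G) :
  quog_le (quog_proj a) (quog_proj b) <-> exists2 h, h \in H & a <= b + h.
Proof.
split=> [/asboolP[a' [b' [ea eb le_ab]]]|[h hH le_ab]].
  have ha : a - a' \in H by apply/quog_proj_eq.
  have hb : b' - b \in H by apply/quog_proj_eq.
  exists ((b' - b) + (a - a')); first exact: rpredD.
  rewrite addrA (addrC b) subrK addrC -{1}(subrK a' a).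
  exact: legD2l.
apply/asboolP; exists a, (b + h); split=> //.
by apply/quog_proj_eq; rewrite addrC addKr.
Qed.

Lemma quog_le_refl : reflexive quog_le.
Proof.
move=> x; case: (quog_projP x) => a <-; apply/quog_leE.
by exists 0; rewrite ?rpred0 ?addr0.
Qed.

Lemma quog_le_anti : antisymmetric quog_le.
Proof.
move=> x y; case: (quog_projP x) => a <-; case: (quog_projP y) => b <-.
case/andP => /quog_leE[h hH le1] /quog_leE[k kH le2].
apply/quog_proj_eq; apply: (@convex_subproof _ H (- k) _ h) => //.
- by rewrite rpredN.
- have := legD2l (- b - k) _ _ le2.
  by rewrite addrAC addNr add0r addrACA addNr addr0 [- b + a]addrC.
- have := legD2l (- b) _ _ le1.
  by rewrite addKr addrC.
Qed.

Lemma quog_le_trans : transitive quog_le.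
Proof.
move=> y x z; case: (quog_projP x) => a <-; case: (quog_projP y) => b <-.
case: (quog_projP z) => c <- /quog_leE[h hH le1] /quog_leE[k kH le2].
apply/quog_leE; exists (k + h); first exact: rpredD.
apply: (le_trans le1); rewrite addrA ![_ + h]addrC; exact: legD2l.
Qed.

Lemma quog_le_total : total quog_le.
Proof.
move=> x y; case: (quog_projP x) => a <-; case: (quog_projP y) => b <-.
case/orP: (leg_total a b) => le_ab; apply/orP; [left|right];
  by apply/quog_leE; exists 0; rewrite ?rpred0 ?addr0.
Qed.

HB.instance Definition _ := Order.Le_isPOrder.Build ring_display quog
  quog_le_refl quog_le_anti quog_le_trans.
Lemma quog_legD2l (z x y : quog) : x <= y -> z + x <= z + y.
Proof.
case: (quog_projP x) => a <-; case: (quog_projP y) => b <-.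
case: (quog_projP z) => c <- /quog_leE[h hH le_ab].
rewrite -!quog_projD; apply/quog_leE; exists h => //.
by rewrite -addrA; exact: legD2l.
Qed.

HB.instance Definition _ :=
  POrderedZmodule_isOrdered.Build quog quog_le_total quog_legD2l.

End OrderedQuotient.

(* [n_divisible n A] is meant for subgroups [A]: the quotient is taken in [A]. *)
Definition n_divisible (G : zmodType) (n : nat) (A : set G) : Prop :=
  forall x, A x -> exists2 y, A y & y *+ n = x.

Definition has_nontrivial_divisible_convex_subgroup
    (n : nat) (Q : orderedZmodType) : Prop :=
  exists C : convexSubgroup Q,
    (exists2 x, x \in C & x != 0) /\ n_divisible n [set` C].

(* For [H'] contained in [H], the group H/H' as a subgroup of G/H'. *)
Definition quog_sub (G : orderedZmodType) (H H' : convexSubgroup G) :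
  set (quog H') := quog_proj H' @` [set` H].
Arguments quog_sub {G} H H' _.

Section NaturalValuation.
Variable G : orderedZmodType.
Implicit Types (a b : G) (A B : set G) (V : set (set G)).

Definition absg a : G := Num.max a (- a).

Definition arch_equiv a b : Prop :=
  exists n : nat, [/\ (0 < n)%N, absg a <= absg b *+ n & absg b <= absg a *+ n].

Definition natval a : set G := [set b | arch_equiv a b].

(* The order is reversed: larger elements have smaller values. *)
Definition natval_lt A B : Prop :=
  exists a b, [/\ A = natval a, B = natval b, absg b < absg a &
                  ~ arch_equiv a b].

Definition natval_le A B : Prop := A = B \/ natval_lt A B.

Definition value_set (S : set G) : set (set G) := natval @` (S `\ 0).

Definition has_maximum V : Prop := exists2 M, V M & forall A, V A -> natval_le A M.

Definition has_minimum V : Prop := exists2 m, V m & forall A, V A -> natval_le m A.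

End NaturalValuation.

(* First-order formulas over {+, -, 0, <} (with equality), with de Bruijn
   indices. *)
Inductive og_term : Type :=
| OgVar of nat
| OgZero
| OgOpp of og_term
| OgAdd of og_term & og_term.

Inductive og_formula : Type :=
| OgEq of og_term & og_term
| OgLt of og_term & og_term
| OgNot of og_formula
| OgAnd of og_formula & og_formula
| OgOr of og_formula & og_formula
| OgImplies of og_formula & og_formula
| OgForall of og_formula
| OgExists of og_formula.

Section Semantics.
Variable G : orderedZmodType.

(* A variable beyond the end of the environment denotes the constant 0. *)
Fixpoint og_eval (e : seq G) (t : og_term) : G :=
  match t with
  | OgVar i => e`_i
  | OgZero => 0
  | OgOpp t => - og_eval e t
  | OgAdd t u => og_eval e t + og_eval e u
  end.

Fixpoint og_holds (e : seq G) (f : og_formula) : Prop :=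
  match f with
  | OgEq t u => og_eval e t = og_eval e u
  | OgLt t u => og_eval e t < og_eval e u
  | OgNot f => ~ og_holds e f
  | OgAnd f g => og_holds e f /\ og_holds e g
  | OgOr f g => og_holds e f \/ og_holds e g
  | OgImplies f g => og_holds e f -> og_holds e g
  | OgForall f => forall x, og_holds (x :: e) f
  | OgExists f => exists x, og_holds (x :: e) f
  end.

(* Variable 0 is the free variable; [ps] is the list of parameters. *)
Definition og_definable (A : set G) : Prop :=
  exists (f : og_formula) (ps : seq G), A = [set x | og_holds (x :: ps) f].

End Semantics.

(* Main.v *)
Require Import Defs.
From HB Require Import structures.
From mathcomp Require Import all_boot all_order all_algebra.
From mathcomp Require Import boolp classical_sets.

(* Write [F_n(g)] for the set of all [x] such that the coset [g + nG] misses
   the interval [[-n|x|, n|x|]]. Subtracting multiples of [n x] shows that a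
   coset meeting some [[-m|x|, m|x|]] already meets [[-n|x|, n|x|]], so
   [F_n(g)] is the largest convex subgroup disjoint from [g + nG] (if [g] is
   not in [nG]), and it is uniformly definable.
   If [G/H] has no non-trivial [n]-divisible convex subgroup, then every [x]
   outside [H] bounds, up to the factor [n], some [g] outside [H + nG]. In (1),
   taking [x] in the smallest class above [H], this gives [H = F_n(g)]. In (3)
   and (4) there is [h] in [H] that lies in no [F_n(g)] with [g] in [H], and [H]
   consists of the [x] such that [h] is in no [F_n(g)] with [|g| <= n|x|].
   In (2) with [H <> 0], pick [c] outside [H] in the [n]-divisible part: then
   [H] is the union of the [F_n(g)] with [|g| <= |c|]. *)

Set Implicit Arguments.
Unset Strict Implicit.
Unset Printing Implicit Defensive.

Local Open Scope classical_set_scope.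

Import Order.TTheory GRing.Theory.
Local Open Scope ring_scope.

(** * Absolute values and reduction modulo [n] *)

Section AbsoluteValue.
Context {G : orderedZmodType}.
Implicit Types (a b c x : G) (m n : nat).

Lemma legD a b c x : a <= b -> c <= x -> a + c <= b + x.
Proof.
move=> ab cx; apply: (@le_trans _ _ (a + x)); first exact: legD2l.
by rewrite ![_ + x]addrC; exact: legD2l.
Qed.

Lemma legN a b : a <= b -> - b <= - a.
Proof. by move=> /(legD2l (- a - b)); rewrite addrAC addNr add0r subrK. Qed.

Lemma ltgNge a b : (a < b) = ~~ (b <= a).
Proof.
rewrite lt_neqAle; have [ab|nab] := boolP (a <= b).
  by rewrite andbT eq_le ab.
by rewrite andbF; have := leg_total a b; rewrite (negbTE nab) /= => ->.
Qed.

Lemma absg_le a c : (absg a <= c) = (a <= c) && (- a <= c).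
Proof.
rewrite /absg maxEle; case: ifP => aa.
  by apply/idP/andP => [ac|[]//]; split=> //; exact: le_trans ac.
have {aa} Naa : - a <= a by have := leg_total a (- a); rewrite aa.
by apply/idP/andP => [ac|[]//]; split=> //; exact: le_trans ac.
Qed.

Lemma le_absg a : a <= absg a.
Proof. by have := absg_le a (absg a); rewrite lexx => /esym/andP[]. Qed.

Lemma leN_absg a : - a <= absg a.
Proof. by have := absg_le a (absg a); rewrite lexx => /esym/andP[]. Qed.

Lemma absgN a : absg (- a) = absg a.
Proof. apply/le_anti; rewrite !absg_le opprK le_absg leN_absg /=.
by rewrite -{1}[a]opprK leN_absg le_absg. Qed.

Lemma absg_cases a : absg a = a \/ absg a = - a.
Proof. by rewrite /absg maxEle; case: ifP; [right|left]. Qed.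

Lemma absg_ge0 a : 0 <= absg a.
Proof.
case/orP: (leg_total 0 a) => [|/legN]; first by move/le_trans; apply; exact: le_absg.
by rewrite oppr0 => /le_trans; apply; exact: leN_absg.
Qed.

Lemma absg_id a : 0 <= a -> absg a = a.
Proof.
move=> a0; apply/le_anti; rewrite le_absg absg_le lexx /= andbT.
by apply: le_trans (a0); rewrite -[leRHS]oppr0 legN.
Qed.

Lemma absg0 : absg (0 : G) = 0. Proof. exact/absg_id/lexx. Qed.

Lemma absgD a b : absg (a + b) <= absg a + absg b.
Proof. by rewrite absg_le opprD !legD ?le_absg ?leN_absg. Qed.

Lemma absg_eq0 a : absg a <= 0 -> a = 0.
Proof.
rewrite absg_le => /andP[a0 /legN]; rewrite opprK oppr0 => a0'.
by apply/le_anti; rewrite a0.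
Qed.

Lemma legMn a b m : a <= b -> a *+ m <= b *+ m.
Proof. by move=> ab; elim: m => [|m IH]; rewrite ?mulr0n// !mulrS legD. Qed.

Lemma mulrng_ge0 a m : 0 <= a -> 0 <= a *+ m.
Proof. by move=> a0; rewrite -(mul0rn _ m) legMn. Qed.

Lemma legMn2r a m n : 0 <= a -> (m <= n)%N -> a *+ m <= a *+ n.
Proof.
move=> a0 /subnK <-; rewrite mulrnDr -[leLHS]add0r.
by apply: legD => //; exact: mulrng_ge0.
Qed.

Lemma absgMn a m : absg (a *+ m) = absg a *+ m.
Proof.
case: (absg_cases a) => e; have := absg_ge0 a; rewrite e => a0.
  by rewrite absg_id // mulrng_ge0.
by rewrite -absgN -mulNrn absg_id // mulrng_ge0.
Qed.

Lemma absg_mod n a b m : (0 < n)%N -> absg a <= absg b *+ m ->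
  exists y, absg (a + y *+ n) <= absg b *+ n.
Proof.
move=> n0; wlog a0 : a / 0 <= a.
  move=> wl am; case/orP: (leg_total 0 a) => a0; first exact: wl.
  case: (wl (- a)) => [||y].
  - by rewrite -oppr0 legN.
  - by rewrite absgN.
  - by exists (- y); rewrite -absgN opprD mulNrn opprK.
rewrite (absg_id a0).
elim: m a a0 => [|m IH] a a0 am.
  by exists 0; rewrite mul0rn addr0 absg_id // (le_trans am) // mulr0n
    mulrng_ge0 // absg_ge0.
have [an|] := boolP (a <= absg b *+ n).
  by exists 0; rewrite mul0rn addr0 absg_id.
(* Passing to [a - absg b *+ n] stays in the coset of [a]. It keeps the element nonnegative by [na],
   and since [n] is positive it lowers the multiple of [absg b] needed as a bound by at least
   one. *)
rewrite -ltgNge => /ltW na.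
have [||y yP] := IH (a - absg b *+ n).
- by have := legD2l (- (absg b *+ n)) _ _ na; rewrite addNr addrC.
- apply: (@le_trans _ _ (a - absg b)).
    by rewrite legD // legN // -{1}(mulr1n (absg b)) legMn2r ?absg_ge0.
  by have := legD2l (- absg b) _ _ am; rewrite mulrS addKr addrC.
by exists (y - absg b); rewrite mulrnBl addrCA addrC.
Qed.

End AbsoluteValue.

(** * The convex subgroup generated by one element *)

Section ConvexHull.
Context {G : orderedZmodType}.
Variable x : G.

Definition arch_hull : pred G := fun z => `[< exists m, absg z <= absg x *+ m >].

Lemma arch_hullP z : reflect (exists m, absg z <= absg x *+ m) (z \in arch_hull).
Proof. exact: asboolP. Qed.

Lemma arch_hull_zmod_closed : zmod_closed arch_hull.
Proof.
split=> [|a b /arch_hullP[m am] /arch_hullP[k bk]]; apply/arch_hullP.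
  by exists 0%N; rewrite absg0.
exists (m + k)%N; rewrite mulrnDr; apply: le_trans (absgD _ _) _.
by rewrite absgN legD.
Qed.

HB.instance Definition _ := GRing.isZmodClosed.Build G arch_hull arch_hull_zmod_closed.

Lemma arch_hull_convex : convex arch_hull.
Proof.
move=> a b c /arch_hullP[m am] /arch_hullP[k ck] ab bc; apply/arch_hullP.
exists (m + k)%N; rewrite mulrnDr absg_le; apply/andP; split.
  rewrite -[b]add0r; apply: legD; first exact/mulrng_ge0/absg_ge0.
  by apply: le_trans bc _; apply: le_trans (le_absg _) ck.
rewrite -[- b]addr0; apply: legD; last exact/mulrng_ge0/absg_ge0.
by apply: le_trans (legN ab) _; apply: le_trans (leN_absg _) am.
Qed.

HB.instance Definition _ := isConvex.Build G arch_hull arch_hull_convex.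

Definition arch_hull_subgroup : convexSubgroup G :=
  ConvexSubgroup.clone G arch_hull _.

Lemma arch_hull_self : x \in arch_hull.
Proof. by apply/arch_hullP; exists 1%N; rewrite mulr1n. Qed.

End ConvexHull.

(** * Convex subgroups and their quotients *)

Section ConvexSubgroups.
Context {G : orderedZmodType} (H : convexSubgroup G).
Implicit Types (a b g h x y z : G) (m n : nat).

Lemma absg_in a : (absg a \in H) = (a \in H).
Proof. by case: (absg_cases a) => ->; rewrite ?rpredN. Qed.

Lemma convex_absg a b : b \in H -> absg a <= absg b -> a \in H.
Proof.
rewrite -absg_in => bH; rewrite absg_le => /andP[ab /legN].
by rewrite opprK => ba; apply: (@convex_subproof _ H _ _ _ _ bH ba ab); rewrite rpredN.
Qed.

Lemma absg_lt_notin h x : h \in H -> x \notin H -> absg h < absg x.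
Proof.
by move=> hH xH; rewrite ltgNge; apply: contra xH; exact: convex_absg.
Qed.

Lemma quog_proj0 : quog_proj H 0 = 0.
Proof. by apply: (addrI (quog_proj H 0)); rewrite -quog_projD !addr0. Qed.

Lemma quog_projN a : quog_proj H (- a) = - quog_proj H a.
Proof. by apply: (addrI (quog_proj H a)); rewrite -quog_projD !subrr quog_proj0. Qed.

Lemma quog_projMn a m : quog_proj H (a *+ m) = quog_proj H a *+ m.
Proof. by elim: m => [|m IH]; rewrite ?quog_proj0 // !mulrS quog_projD IH. Qed.

Lemma quog_proj_le a b : a <= b -> quog_proj H a <= quog_proj H b.
Proof. by move=> ab; apply/quog_leE; exists 0; rewrite ?rpred0 ?addr0. Qed.

Lemma absg_quog_proj a : absg (quog_proj H a) = quog_proj H (absg a).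
Proof.
case/orP: (leg_total 0 a) => a0.
  by rewrite !absg_id // -quog_proj0 quog_proj_le.
have na : 0 <= - a by rewrite -oppr0 legN.
rewrite -absgN -quog_projN -[absg a]absgN !absg_id // -quog_proj0.
exact: quog_proj_le.
Qed.

Lemma convex_muln n x : (0 < n)%N -> x *+ n \in H -> x \in H.
Proof.
move=> n0 /convex_absg; apply; rewrite absgMn -{1}(mulr1n (absg x)).
by apply: legMn2r => //; exact: absg_ge0.
Qed.

Lemma convex_absg_muln n a b : b \in H -> absg a <= absg b *+ n -> a \in H.
Proof. by move=> bH; rewrite -absgMn; apply: convex_absg; rewrite rpredMn. Qed.

(** The convex subgroup generated by the image of [x] in G/H is non-trivial, hence not
    [n]-divisible. A lift of an element without [n]-th part, reduced modulo [n], is the desired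
    [g]. *)
Lemma nondivisible_witness n x : (0 < n)%N ->
    ~ has_nontrivial_divisible_convex_subgroup n (quog H) -> x \notin H ->
  exists2 g, absg g <= absg x *+ n & forall y, g + y *+ n \notin H.
Proof.
move=> n0 ndiv xH.
have [q qx qn] : exists2 q : quog H, q \in arch_hull (quog_proj H x) &
    forall y : quog H, y *+ n <> q.
  apply: contrapT => noq; apply: ndiv; exists (arch_hull_subgroup (quog_proj H x)).
  split.
    exists (quog_proj H x); first exact: arch_hull_self.
    by apply: contra xH => /eqP; rewrite -quog_proj0 => /quog_proj_eq; rewrite subr0.
  move=> q qx; apply: contrapT => noy; apply: noq; exists q => // y yq.
  apply: noy; exists y => //; move: qx => /arch_hullP[m qm]; apply/arch_hullP.
  exists m; apply: le_trans qm; rewrite -yq absgMn -{1}(mulr1n (absg y)).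
  by apply: legMn2r => //; exact: absg_ge0.
case: (quog_projP q) => g gq; move: qx qn; rewrite -{}gq => /arch_hullP[m].
rewrite !absg_quog_proj -quog_projMn => /quog_leE[h hH gm] gn.
(* The extra summand absorbs the error [h], which lies in [H] and so below [absg x]. *)
have gm1 : absg g <= absg x *+ m.+1.
  apply: le_trans gm _; rewrite mulrSr; apply: legD => //.
  by apply: le_trans (le_absg _) _; exact/ltW/absg_lt_notin.
case: (absg_mod n0 gm1) => y gy; exists (g + y *+ n) => // z.
rewrite -addrA -mulrnDl; apply/negP => gzH; apply: (gn (quog_proj H (- (y + z)))).
apply/esym; rewrite -quog_projMn; apply/quog_proj_eq.
by rewrite mulNrn opprK.
Qed.

End ConvexSubgroups.

(** * Formulas for absolute values and for [F_n] *)

Section Formulas.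

Fixpoint og_muln (n : nat) (t : og_term) : og_term :=
  if n is m.+1 then OgAdd t (og_muln m t) else OgZero.

Definition og_le (t u : og_term) : og_formula := OgNot (OgLt u t).

(** Absolute value is not a term of the language; since [absg u] is [u] or [- u], the comparison
    becomes a disjunction over these two cases. *)
Definition og_absle (t u : og_term) : og_formula :=
  OgOr (OgAnd (og_le t u) (og_le (OgOpp t) u))
       (OgAnd (og_le t (OgOpp u)) (og_le (OgOpp t) (OgOpp u))).

(* Variable [j] is in [F_n] of variable [i]. *)
Definition og_misses (n i j : nat) : og_formula :=
  OgNot (OgExists (og_absle (OgAdd (OgVar i.+1) (og_muln n (OgVar 0)))
                            (og_muln n (OgVar j.+1)))).

Context {G : orderedZmodType}.
Implicit Types (e : seq G) (t u : og_term).

Lemma og_eval_muln e n t : og_eval e (og_muln n t) = og_eval e t *+ n.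
Proof. by elim: n => //= n ->; rewrite mulrS. Qed.

Lemma og_holds_le e t u : og_holds e (og_le t u) <-> og_eval e t <= og_eval e u.
Proof. by rewrite /= ltgNge; split=> [/negP|le_tu]; rewrite ?negbK // le_tu. Qed.

Lemma og_holds_absle e t u :
  og_holds e (og_absle t u) <-> absg (og_eval e t) <= absg (og_eval e u).
Proof.
rewrite /og_absle; cbn [og_holds]; rewrite !og_holds_le /=.
set a := og_eval e t; set b := og_eval e u; split.
  case=> [[h1 h2]|[h1 h2]].
    by apply: le_trans (le_absg b); rewrite absg_le h1.
  by apply: le_trans (leN_absg b); rewrite absg_le h1.
by rewrite absg_le => /andP[]; case: (absg_cases b) => -> ? ?; [left|right].
Qed.

Lemma og_holds_misses e n i j :
  og_holds e (og_misses n i j) <-> forall y, ~ absg (e`_i + y *+ n) <= absg e`_j *+ n.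
Proof.
have abs y : og_holds (y :: e) (og_absle (OgAdd (OgVar i.+1) (og_muln n (OgVar 0)))
      (og_muln n (OgVar j.+1))) <-> absg (e`_i + y *+ n) <= absg e`_j *+ n.
  by rewrite -absgMn; split=> h; [move/og_holds_absle: h | apply/og_holds_absle];
    rewrite /= !og_eval_muln.
rewrite /og_misses; cbn [og_holds]; split=> [ne y /abs ay|ne [y /abs]]; last exact: ne.
by apply: ne; exists y.
Qed.

End Formulas.

(** * The natural valuation in terms of multiples *)

Section Valuation.
Context {G : orderedZmodType}.
Implicit Types a b x : G.

Lemma arch_equiv_refl a : arch_equiv a a.
Proof. by exists 1%N; rewrite !mulr1n. Qed.

Lemma arch_equiv_sym a b : arch_equiv a b -> arch_equiv b a.
Proof. by case=> n [n0 ab ba]; exists n. Qed.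

Lemma leg_muln_trans (a b c : G) m n : a <= b *+ m -> b <= c *+ n -> a <= c *+ (n * m).
Proof. by move=> am /(legMn m); rewrite -mulrnA; exact: le_trans. Qed.

Lemma arch_equiv_trans a b x : arch_equiv a b -> arch_equiv b x -> arch_equiv a x.
Proof.
case=> m [m0 ab ba] [n [n0 bx xb]]; exists (n * m)%N; split.
- by rewrite muln_gt0 n0.
- exact: leg_muln_trans bx.
- by rewrite mulnC; exact: leg_muln_trans ba.
Qed.

Lemma natval_eq a b : natval a = natval b <-> arch_equiv a b.
Proof.
split=> [eab|ab].
  have : natval b b by exact: arch_equiv_refl.
  by rewrite -eab.
apply/seteqP; split=> x; last exact: arch_equiv_trans.
exact/arch_equiv_trans/arch_equiv_sym.
Qed.

Lemma natval_leP x a :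
  natval_le (natval x) (natval a) <-> exists m, absg a <= absg x *+ m.
Proof.
split=> [[/natval_eq[m []]|[x' [a' [/natval_eq[m [_ _ x'x]]
  /natval_eq[k [_ aa' _]] a'x' _]]]]|[m am]].
- by exists m.
- exists (m * k)%N; apply: leg_muln_trans aa' _; exact: le_trans (ltW a'x') x'x.
have [/natval_eq|xa] := pselect (arch_equiv x a); first by left.
right; exists x, a; split=> //; rewrite ltgNge; apply/negP => le_xa; apply: xa.
(* The successor keeps the factor positive even if [m] is 0. *)
exists m.+1; split=> //.
  by apply: le_trans le_xa _; rewrite -{1}(mulr1n (absg a)) legMn2r ?absg_ge0.
by apply: le_trans am _; rewrite legMn2r ?absg_ge0.
Qed.

End Valuation.

(** * Three definability criteria *)

Section Definability.
Context {G : orderedZmodType} (H : convexSubgroup G).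
Implicit Types (n : nat) (a c h x : G).

(** The coset of the witness [g] misses [H], so [F_n(g)] contains [H]. Any [x] outside [H] has a
    multiple above [a], hence above [g], so the coset meets the interval around [x]. *)
Lemma definable_of_minimal_above n a : (0 < n)%N ->
    ~ has_nontrivial_divisible_convex_subgroup n (quog H) -> a \notin H ->
    (forall x, x \notin H -> exists m, absg a <= absg x *+ m) ->
  og_definable [set` H].
Proof.
move=> n0 ndiv aH amin.
have [g ga gn] := nondivisible_witness n0 ndiv aH.
exists (og_misses n 1 0), [:: g].
apply/seteqP; split=> x => [xH|]; rewrite /mkset.
  apply/og_holds_misses => /= y /convex_absg_muln => /(_ H xH).
  exact/negP.
move=> /og_holds_misses/= gx.
apply: contrapT => /negP /amin[m /(leg_muln_trans ga)] /(absg_mod n0)[y].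
exact: gx.
Qed.

(** For [absg g <= absg c] the coset of [g] meets [H], and every [x] outside [H] exceeds the meeting
    point; so [F_n(g)] stays inside [H]. The last hypothesis makes these sets cover [H]. *)
Lemma definable_divisible_above n c : (0 < n)%N -> c \notin H ->
    (forall g, absg g <= absg c -> exists y, g + y *+ n \in H) ->
    (forall x, x \in H -> exists2 g, g \in H &
      forall y, ~ absg (g + y *+ n) <= absg x *+ n) ->
  og_definable [set` H].
Proof.
move=> n0 cH cdiv Hndiv.
(* Under the quantifier, variables 0, 1, 2 are [g], [x], [c]. *)
exists (OgExists (OgAnd (og_absle (OgVar 0) (OgVar 2))
                        (og_misses n 0 1))), [:: c].
apply/seteqP; split=> x.
  move=> /Hndiv[g gH gx]; exists g; split.
    exact/og_holds_absle/ltW/(absg_lt_notin gH).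
  exact/og_holds_misses.
case=> g [/og_holds_absle gc /og_holds_misses/= gx].
have [y yH] := cdiv _ gc.
apply: contrapT => /negP xH; apply: (gx y).
apply: le_trans (ltW (absg_lt_notin yH xH)) _.
by rewrite -{1}(mulr1n (absg x)) legMn2r ?absg_ge0.
Qed.

Lemma definable_bound_in n h : (0 < n)%N ->
    ~ has_nontrivial_divisible_convex_subgroup n (quog H) -> h \in H ->
    (forall g, g \in H -> exists y, absg (g + y *+ n) <= absg h *+ n) ->
  og_definable [set` H].
Proof.
move=> n0 ndiv hH hdiv.
(* Variables 0, 1, 2 are [g], [x], [h]. For [x] in [H] the bound puts [g] in [H]; for [x] outside
   [H] the witness coset misses all of [H], in particular the interval around [h]. *)
exists (OgNot (OgExists (OgAnd (og_absle (OgVar 0) (og_muln n (OgVar 1)))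
                               (og_misses n 0 2)))), [:: h].
apply/seteqP; split=> x.
  move=> xH [g [/og_holds_absle gx /og_holds_misses/= gh]]; move: gx.
  by rewrite /= og_eval_muln absgMn => /(convex_absg_muln xH) /hdiv[y /gh].
move=> nx; apply: contrapT => /negP xH; apply: nx.
have [g gx gn] := nondivisible_witness n0 ndiv xH.
exists g; split; first by apply/og_holds_absle; rewrite /= og_eval_muln absgMn.
apply/og_holds_misses => /= y /(convex_absg_muln hH).
exact/negP.
Qed.

End Definability.

Theorem corollary4p8 (G : orderedZmodType) (H : convexSubgroup G)
    (properH : [set` H] `<` [set: G]) :
  let Gamma := value_set [set: G] in
  let Gamma_H := value_set [set` H] in
  [/\ has_maximum (Gamma `\` Gamma_H) ->
      (exists2 n : nat, (2 <= n)%N &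
        ~ has_nontrivial_divisible_convex_subgroup n (quog H)) ->
      og_definable [set` H],

      (exists n : nat,
        [/\ (2 <= n)%N,
            has_nontrivial_divisible_convex_subgroup n (quog H),
            ~ has_minimum Gamma_H &
            forall H' : convexSubgroup G, [set` H'] `<` [set` H] ->
              ~ n_divisible n (quog_sub H H')]) ->
      og_definable [set` H],

      (exists n : nat,
        [/\ (2 <= n)%N,
            ~ has_nontrivial_divisible_convex_subgroup n (quog H) &
            has_minimum Gamma_H]) ->
      og_definable [set` H] &

      (exists n : nat,
        [/\ (2 <= n)%N,
            ~ has_nontrivial_divisible_convex_subgroup n (quog H) &
            exists2 H' : convexSubgroup G, [set` H'] `<` [set` H] &
              n_divisible n (quog_sub H H')]) ->
      og_definable [set` H]].
Proof.
move=> Gamma Gamma_H; split.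
- move=> [_ [[a [_ a0] <-] aH] amax] [n /ltnW n0 ndiv].
  apply: (definable_of_minimal_above n0 ndiv (a := a)).
    by apply/negP => aH'; apply: aH; exists a.
  move=> x xH; apply/natval_leP/amax; split.
    by exists x => //; split=> // x0; move: xH; rewrite x0 rpred0.
  (* An element of [H] equivalent to [x] would force [x] into [H] by convexity. *)
  case=> b [bH _] /natval_eq/arch_equiv_sym[m [_ xb _]].
  by move/negP: xH; apply; exact: convex_absg_muln xb.
- case=> n [/ltnW n0 [C [[q qC q0] Cdiv]] nomin Hndiv].
  (* The trivial subgroup satisfies the conditions on [H] vacuously: its value set is empty and it
     has no proper subgroup. It is defined by [x = 0]. *)
  have [[h hH h0]|Htriv] := pselect (exists2 h, h \in H & h != 0); last first.
    exists (OgEq (OgVar 0) OgZero), [::]; apply/seteqP; split=> x /=.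
      by move=> xH; apply: contrapT => /eqP x0; apply: Htriv; exists x.
    by move=> ->; exact: rpred0.
  have [c cq] := quog_projP q; rewrite -{}cq in qC q0.
  apply: (definable_divisible_above n0 (c := c)).
  + apply: contra q0 => cH; rewrite -(quog_proj0 H); apply/eqP/quog_proj_eq.
    by rewrite subr0.
  + move=> g gc; have /Cdiv[z _] : quog_proj H g \in C.
      by apply: convex_absg qC _; rewrite !absg_quog_proj quog_proj_le.
    have [y <-] := quog_projP z; rewrite -quog_projMn => /esym/quog_proj_eq.
    by rewrite -mulNrn; exists (- y).
  (* The hull of [x] is proper in [H], since otherwise the class of [x] would be the minimum of
     [Gamma_H]. So H modulo the hull is not [n]-divisible, and an element without [n]-th part there
     gives [g]. *)
  + move=> x xH; have hull_sub z : z \in arch_hull x -> z \in H.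
      by case/arch_hullP => m; exact: convex_absg_muln.
    have hull_proper : [set` arch_hull_subgroup x] `<` [set` H].
      split=> [z|H_sub]; first exact: hull_sub.
      apply: nomin; exists (natval x).
        exists x => //; split=> // x0; move: (H_sub _ hH) h0.
        by case/arch_hullP => m; rewrite x0 absg0 mul0rn => /absg_eq0 ->; rewrite eqxx.
      by move=> _ [z [zH _] <-]; apply/natval_leP/arch_hullP/H_sub.
    apply: contrapT => ndiv; apply: (Hndiv _ hull_proper) => _ [g gH <-].
    apply: contrapT => noy; apply: ndiv; exists g => // y gy.
    have gyx : g + y *+ n \in arch_hull x by apply/arch_hullP; exists n.
    apply: noy; exists (quog_proj _ (- y)); last first.
      rewrite -quog_projMn; apply/esym/quog_proj_eq.
      by rewrite mulNrn opprK.
    (* The [n]-th part must come from [H]: [y *+ n] is the difference of [g + y *+ n] and [g], both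
       in [H]. *)
    exists (- y) => //=; rewrite rpredN; apply: (convex_muln n0).
    by rewrite -(addKr g (y *+ n)) rpredD ?rpredN // hull_sub.
- case=> n [/ltnW n0 ndiv [_ [h [hH h0] <-] hmin]].
  apply: (definable_bound_in n0 ndiv hH) => g gH.
  (* Zero has no class in [Gamma_H]; any other [g] in [H] is bounded by a multiple of [h], whose
     class is minimal. *)
  have [->|/eqP g0] := eqVneq g 0.
    by exists 0; rewrite mul0rn addr0 absg0 mulrng_ge0 ?absg_ge0.
  have /hmin/natval_leP[m] : Gamma_H (natval g) by exists g.
  exact: absg_mod.
- case=> n [/ltnW n0 ndiv [H' [_ H'H] H'div]].
  have [h hH hH'] : exists2 h, h \in H & h \notin H'.
    apply: contrapT => noh; apply: H'H => h hH.
    by apply: contrapT => /negP hH'; apply: noh; exists h.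
  apply: (definable_bound_in n0 ndiv hH) => g gH.
  (* Modulo [n] the element [g] is congruent to one of [H'], and such an element is smaller than
     [h], which lies outside [H']. *)
  have [|z [y yH <-]] := H'div (quog_proj H' g); first by exists g.
  rewrite -quog_projMn => /esym/quog_proj_eq; rewrite -mulNrn => gy.
  exists (- y); apply: le_trans (ltW (absg_lt_notin gy hH')) _.
  by rewrite -{1}(mulr1n (absg h)) legMn2r ?absg_ge0.
Qed.
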